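(* Let $\mathcal{D}$ be a triangulated category with a presilting subcategory $\mathcal{P}$ such that $\mathcal{P}$ is contravariantly finite in $\mathcal{D}$, there is an integer $m<0$ with $\operatorname{Hom}(\mathcal{P},\mathcal{P}[i])=0$ for all $i<m$, and $(\mathcal{D}^{\le 0}_{\mathcal{P}},\mathcal{D}^{\ge 0}_{\mathcal{P}})$ is a non-degenerate $t$-structure on $\mathcal{D}$. Let $d$ be a positive integer and $d\text{-}\mathcal{H}=\mathcal{D}^{[-d+1,0]}$. Assume $\mathcal{P}\subseteq d\text{-}\mathcal{H}$ and that $d\text{-}\mathcal{H}$ has enough injectives. Then $\mathcal{M}\mapsto\operatorname{Fac}_d(\mathcal{M})$ defines an injective map from the set of contravariantly finite $\mathbb{E}$-universal tilting subcategories of $d\text{-}\mathcal{H}$ to the set of $s$-torsion classes in $d\text{-}\mathcal{H}$ that contain all ($\mathbb{E}$-)injective objects of $d\text{-}\mathcal{H}$.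
   Context: Conventions: $[1]$ is the shift functor of a triangulated category. $\operatorname{add}\mathcal{X}$ is the full subcategory of direct summands of finite direct sums of objects of $\mathcal{X}$. A subcategory of an additive category means a full subcategory $\mathcal{X}$ with $\mathcal{X}=\operatorname{add}\mathcal{X}$. $\operatorname{Hom}(\mathcal{X},\mathcal{Y})=0$ means $\operatorname{Hom}(X,Y)=0$ for all $X\in\mathcal{X}$, $Y\in\mathcal{Y}$, similarly for other bifunctors. A morphism $f:X\to Y$ is a right $\mathcal{X}$-approximation of $Y$ if $X\in\mathcal{X}$ and every morphism $X'\to Y$ with $X'\in\mathcal{X}$ factors through $f$; $\mathcal{X}$ is contravariantly finite in $\mathcal{C}$ if every object of $\mathcal{C}$ has a right $\mathcal{X}$-approximation. $\mathcal{P}$ is presilting if $\operatorname{Hom}(\mathcal{P},\mathcal{P}[i])=0$ for all $i>0$. $\mathcal{D}^{\le 0}_{\mathcal{P}}=\{Y\in\mathcal{D}\mid \operatorname{Hom}(\mathcal{P},Y[i])=0\ \forall i>0\}$, $\mathcal{D}^{\ge 0}_{\mathcal{P}}=\{Y\in\mathcal{D}\mid \operatorname{Hom}(\mathcal{P},Y[i])=0\ \forall i<0\}$, $\mathcal{D}^{\le q}=\mathcal{D}^{\le 0}_{\mathcal{P}}[-q]$, $\mathcal{D}^{\ge q}=\mathcal{D}^{\ge 0}_{\mathcal{P}}[-q]$, $\mathcal{D}^{[p,q]}=\mathcal{D}^{\le q}\cap\mathcal{D}^{\ge p}$. For $M,N\in d\text{-}\mathcal{H}$ and $i>0$ put $\mathbb{E}^i(M,N)=\operatorname{Hom}(M,N[i])$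 and $\mathbb{E}=\mathbb{E}^1$. An extriangle is a sequence $N\to L\to M$ with $N,L,M\in d\text{-}\mathcal{H}$ that is part of a triangle $N\to L\to M\to N[1]$ in $\mathcal{D}$. For a full subcategory $\mathcal{X}$ of $d\text{-}\mathcal{H}$ and $s\ge1$, $\operatorname{Fac}_s(\mathcal{X})$ is the full subcategory of objects $Z_0\in d\text{-}\mathcal{H}$ for which there are extriangles $Z_i\to X_i\to Z_{i-1}$, $1\le i\le s$, with $X_1,\dots,X_s\in\mathcal{X}$. An object $I\in d\text{-}\mathcal{H}$ is $\mathbb{E}$-injective if $\mathbb{E}(X,I)=0$ for all $X\in d\text{-}\mathcal{H}$. $d\text{-}\mathcal{H}$ has enough injectives if every $X\in d\text{-}\mathcal{H}$ admits an extriangle $X\to I\to Y$ with $I$ $\mathbb{E}$-injective. (When $\mathcal{P}\subseteq d\text{-}\mathcal{H}$, $\mathcal{P}$ is the class of $\mathbb{E}$-projective objects of $d\text{-}\mathcal{H}$, and $d\text{-}\mathcal{H}$ has enough projectives.) A pair of subcategories $(\mathcal{T},\mathcal{F})$ of $d\text{-}\mathcal{H}$ is an $s$-torsion pair, with $s$-torsion class $\mathcal{T}$, if $\operatorname{Hom}(\mathcal{T},\mathcal{F})=0=\operatorname{Hom}(\mathcal{T},\mathcal{F}[-1])$ and every $X\in d\text{-}\mathcal{H}$ admits an extriangle $T\to X\to F$ with $T\in\mathcal{T}$, $F\in\mathcal{F}$. A subcategory $\mathcal{M}$ of $d\text{-}\mathcal{H}$ is $\mathbb{E}$-universal if for any $X\in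 d\text{-}\mathcal{H}$ there is an extriangle $X\to Y\to M$ with $M\in\mathcal{M}$ such that for any $M'\in\mathcal{M}$ the induced map $\operatorname{Hom}(M',M)\to\mathbb{E}(M',X)$ is surjective. ''Contravariantly finite'' for $\mathcal{M}$ means contravariantly finite in $d\text{-}\mathcal{H}$. $M\in d\text{-}\mathcal{H}$ has projective dimension at most $n$ if there are extriangles $Z_i\to P_{i-1}\to Z_{i-1}$, $i>0$, with $Z_0=M$, all $P_{i-1}\in\mathcal{P}$, and $Z_n\in\mathcal{P}$. A subcategory $\mathcal{M}$ of $d\text{-}\mathcal{H}$ is tilting if: every object of $\mathcal{M}$ has projective dimension at most $d$; $\mathbb{E}^i(\mathcal{M},\mathcal{M})=0$ for all $i>0$; and for any $P\in\mathcal{P}$ there are extriangles $Y_{i-1}\to M_{i-1}\to Y_i$, $1\le i\le r$, for some $r$, with $Y_0=P$ and $M_0,\dots,M_{r-1},Y_r\in\mathcal{M}$. *)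

(* Defs.v *)
From HB Require Import structures.
From mathcomp Require Import all_boot all_order all_algebra.
From mathcomp Require Import boolp classical_sets functions.

Set Implicit Arguments.
Unset Strict Implicit.
Unset Printing Implicit Defensive.

Import Order.TTheory GRing.Theory Num.Theory.

Local Open Scope classical_set_scope.
Local Open Scope ring_scope.

Record preadditive := Preadditive {
  obj :> Type;
  hom : obj -> obj -> zmodType;
  idm : forall X, hom X X;
  hcomp : forall {X Y Z}, hom Y Z -> hom X Y -> hom X Z;
  hcompA : forall X Y Z W (h : hom Z W) (g : hom Y Z) (f : hom X Y),
    hcomp h (hcomp g f) = hcomp (hcomp h g) f;
  hcomp1m : forall X Y (f : hom X Y), hcomp (idm Y) f = f;
  hcompm1 : forall X Y (f : hom X Y), hcomp f (idm X) = f;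
  hcompDl : forall X Y Z (g g' : hom Y Z) (f : hom X Y),
    hcomp (g + g') f = hcomp g f + hcomp g' f;
  hcompDr : forall X Y Z (g : hom Y Z) (f f' : hom X Y),
    hcomp g (f + f') = hcomp g f + hcomp g f'
}.

Notation "g \oc f" := (hcomp g f) (at level 50, left associativity) : ring_scope.

Section Additive.
Variable C : preadditive.
Implicit Types X Y Z S : C.

Definition is_zero Z : Prop := idm Z = 0.

Definition is_iso X Y (f : hom X Y) : Prop :=
  exists g : hom Y X, g \oc f = idm X /\ f \oc g = idm Y.

Definition iso_obj X Y : Prop := exists f : hom X Y, is_iso f.

Definition is_dsum (I : finType) (F : I -> C) S : Prop :=
  exists (inj : forall k, hom (F k) S) (prj : forall k, hom S (F k)),
    [/\ forall k, prj k \oc inj k = idm (F k),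
        forall j k, j != k -> prj k \oc inj j = 0
      & \sum_k (inj k \oc prj k) = idm S].

(* For n = 0 this provides a zero object. *)
Definition additive_cat : Prop :=
  forall n (F : 'I_n -> C), exists S, is_dsum F S.

Definition is_summand Y S : Prop :=
  exists Y', is_dsum (fun b : bool => if b then Y else Y') S.

Definition add_closure (A : set C) : set C :=
  [set Y | exists n (F : 'I_n -> C) S,
     [/\ forall k, A (F k), is_dsum F S & is_summand Y S]].

Definition subcategory (A : set C) : Prop := A = add_closure A.

Definition subcategory_of (H A : set C) : Prop := A `<=` H /\ subcategory A.

Definition right_approx (A : set C) W Y (f : hom W Y) : Prop :=
  A W /\ forall W' (g : hom W' Y), A W' -> exists h : hom W' W, f \oc h = g.

Definition contravariantly_finite (A H : set C) : Prop :=
  forall Y, H Y -> exists W (f : hom W Y), right_approx A f.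

End Additive.

(* The shift is an autoequivalence: a fully faithful additive functor together
   with a choice of preimages, up to isomorphism, of all objects. *)
Record triangulated := Triangulated {
  tcat :> preadditive;
  tcat_additive : additive_cat tcat;
  shift : tcat -> tcat;
  shiftm : forall {X Y : tcat}, hom X Y -> hom (shift X) (shift Y);
  shiftm1 : forall X : tcat, shiftm (idm X) = idm (shift X);
  shiftm_comp : forall (X Y Z : tcat) (g : hom Y Z) (f : hom X Y),
    shiftm (g \oc f) = shiftm g \oc shiftm f;
  shiftmD : forall (X Y : tcat) (f g : hom X Y),
    shiftm (f + g) = shiftm f + shiftm g;
  shiftm_bij : forall X Y : tcat, bijective (@shiftm X Y);
  unshift : tcat -> tcat;
  unshiftK : forall X, iso_obj (shift (unshift X)) X;
  dist : forall {X Y Z : tcat}, hom X Y -> hom Y Z -> hom Z (shift X) -> Prop;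
  dist_iso : forall (X Y Z X' Y' Z' : tcat)
    (f : hom X Y) (g : hom Y Z) (h : hom Z (shift X))
    (f' : hom X' Y') (g' : hom Y' Z') (h' : hom Z' (shift X'))
    (a : hom X X') (b : hom Y Y') (c : hom Z Z'),
    is_iso a -> is_iso b -> is_iso c ->
    b \oc f = f' \oc a -> c \oc g = g' \oc b -> shiftm a \oc h = h' \oc c ->
    dist f g h -> dist f' g' h';
  dist_id : forall X Z : tcat, is_zero Z ->
    dist (idm X) (0 : hom X Z) (0 : hom Z (shift X));
  dist_cone : forall (X Y : tcat) (f : hom X Y),
    exists Z (g : hom Y Z) (h : hom Z (shift X)), dist f g h;
  dist_rot : forall (X Y Z : tcat)
    (f : hom X Y) (g : hom Y Z) (h : hom Z (shift X)),
    dist f g h <-> dist g h (- shiftm f);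
  dist_mor : forall (X Y Z X' Y' Z' : tcat)
    (f : hom X Y) (g : hom Y Z) (h : hom Z (shift X))
    (f' : hom X' Y') (g' : hom Y' Z') (h' : hom Z' (shift X'))
    (a : hom X X') (b : hom Y Y'),
    dist f g h -> dist f' g' h' -> b \oc f = f' \oc a ->
    exists c : hom Z Z', c \oc g = g' \oc b /\ shiftm a \oc h = h' \oc c;
  dist_octahedral : forall (X Y Z X' Y' Z' : tcat)
    (f : hom X Y) (i : hom Y Z') (j : hom Z' (shift X))
    (g : hom Y Z) (k : hom Z X') (l : hom X' (shift Y))
    (m : hom Z Y') (n : hom Y' (shift X)),
    dist f i j -> dist g k l -> dist (g \oc f) m n ->
    exists (u : hom Z' Y') (v : hom Y' X'),
      [/\ dist u v (shiftm i \oc l),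
          u \oc i = m \oc g, n \oc u = j,
          v \oc m = k & l \oc v = shiftm f \oc n]
}.

Section Triangulated.
Variable D : triangulated.
Implicit Types (X Y Z : D) (A B H P M T F U V : set D).

Definition sh (n : int) X : D :=
  match n with
  | Posz k => iter k (@shift D) X
  | Negz k => iter k.+1 (@unshift D) X
  end.

(* Hom(A, B[i]) = 0 *)
Definition Hom0 A B (i : int) : Prop :=
  forall X Y, A X -> B Y -> forall f : hom X (sh i Y), f = 0.

(* A[n], closed under isomorphism *)
Definition shset A (n : int) : set D :=
  [set X | exists2 Y, A Y & iso_obj X (sh n Y)].

Definition presilting P : Prop :=
  subcategory P /\ forall i : int, 0 < i -> Hom0 P P i.

Definition Dle0 P : set D :=
  [set Y | forall i : int, 0 < i -> Hom0 P [set Y] i].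
Definition Dge0 P : set D :=
  [set Y | forall i : int, i < 0 -> Hom0 P [set Y] i].
Definition Dle P (q : int) : set D := shset (Dle0 P) (- q).
Definition Dge P (q : int) : set D := shset (Dge0 P) (- q).
Definition Dint P (p q : int) : set D := Dle P q `&` Dge P p.

Definition dH P (d : nat) : set D := Dint P (- d%:Z + 1) 0.

Record tstructure U V : Prop := TStructure {
  tstr_subcatl : subcategory U;
  tstr_subcatr : subcategory V;
  tstr_shiftl : shset U 1 `<=` U;
  tstr_shiftr : shset V (- 1) `<=` V;
  tstr_hom0 : Hom0 U V (- 1);
  tstr_tri : forall X, exists Y Z
    (f : hom Y X) (g : hom X (sh (- 1) Z)) (h : hom (sh (- 1) Z) (shift Y)),
    [/\ U Y, V Z & dist f g h]
}.

Definition nondegenerate_tstr U V : Prop :=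
  (forall X, (forall n, shset U n X) -> is_zero X) /\
  (forall X, (forall n, shset V n X) -> is_zero X).

Definition is_extriangle H X Y Z
    (f : hom X Y) (g : hom Y Z) (h : hom Z (shift X)) : Prop :=
  [/\ H X, H Y, H Z & dist f g h].

Definition extriangle H X Y Z : Prop :=
  exists (f : hom X Y) (g : hom Y Z) (h : hom Z (shift X)),
    is_extriangle H f g h.

Definition Fac H (s : nat) A : set D :=
  [set Z0 | H Z0 /\ exists Z X : nat -> D, Z 0%N = Z0 /\
     forall i : nat, (1 <= i <= s)%N ->
       A (X i) /\ extriangle H (Z i) (X i) (Z i.-1)].

Definition Einjective H : set D := [set I | H I /\ Hom0 H [set I] 1].

Definition enough_injectives H : Prop :=
  forall X, H X -> exists I Y, Einjective H I /\ extriangle H X I Y.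

Definition storsion_pair H T F : Prop :=
  [/\ subcategory_of H T, subcategory_of H F, Hom0 T F 0, Hom0 T F (- 1)
    & forall X, H X -> exists Y Z, [/\ T Y, F Z & extriangle H Y X Z]].

Definition storsion_class H T : Prop := exists F, storsion_pair H T F.

Definition Euniversal H M : Prop :=
  forall X, H X -> exists Y N
    (f : hom X Y) (g : hom Y N) (h : hom N (shift X)),
    [/\ M N, is_extriangle H f g h
      & forall N' (e : hom N' (shift X)), M N' ->
          exists u : hom N' N, h \oc u = e].

Definition pdim_le H P (n : nat) X : Prop :=
  exists Z Q : nat -> D, [/\ Z 0%N = X, P (Z n)
    & forall i : nat, (0 < i)%N ->
        P (Q i.-1) /\ extriangle H (Z i) (Q i.-1) (Z i.-1)].

Definition tilting H P (d : nat) M : Prop :=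
  [/\ subcategory_of H M,
      forall X, M X -> pdim_le H P d X,
      forall i : int, 0 < i -> Hom0 M M i
    & forall X, P X -> exists (r : nat) (Y N : nat -> D),
        [/\ Y 0%N = X, M (Y r)
          & forall i : nat, (1 <= i <= r)%N ->
              M (N i.-1) /\ extriangle H (Y i.-1) (N i.-1) (Y i)]].

End Triangulated.

(* Main.v *)
(** For a tilting subcategory M put T = {X in H | Hom(M, X[k]) = 0 for all k > 0}.
Dimension shifting along projective resolutions of length d gives Fac_d(M) in T.
Conversely, the fibre Z of a right M-approximation N -> X of X in T again
satisfies Hom(M, Z[k]) = 0 for k > 0; since P is coresolved by M this forces Z
into the heart, so Z is in T and Fac_d(M) = T.  If moreover Hom(X, T[1]) = 0 the
approximation splits, hence M is recovered from T as its Ext-projectives.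

For the torsion triangle of X in H, successive cones of approximations by M[i],
0 <= i < 2d, produce X -> Y with Hom(M[i], Y) = 0 for these i.  Objects of P have
M-coresolutions of length at most d, so Y has no cohomology in degrees
-2d+1, ..., -d.  Hence the truncation F of Y to degrees >= 1-d still satisfies
Hom(M[i], F) = 0 for i >= 0, and the fibre of X -> F lies in T. *)

From mathcomp Require Import all_boot all_order all_algebra.
From mathcomp Require Import boolp classical_sets functions.
From mathcomp Require Import zify.
Require Import Defs.

Set Implicit Arguments.
Unset Strict Implicit.
Unset Printing Implicit Defensive.

Import Order.TTheory GRing.Theory Num.Theory.

Local Open Scope classical_set_scope.
Local Open Scope ring_scope.

(** * Bilinearity of composition, isomorphisms and summands *)

Section Preadditive.
Variable C : preadditive.
Implicit Types X Y Z W S : C.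

Lemma comp0m X Y Z (f : hom X Y) : (0 : hom Y Z) \oc f = 0.
Proof. by apply: (addrI (0 \oc f)); rewrite -hcompDl !addr0. Qed.

Lemma compm0 X Y Z (g : hom Y Z) : g \oc (0 : hom X Y) = 0.
Proof. by apply: (addrI (g \oc 0)); rewrite -hcompDr !addr0. Qed.

Lemma compNm X Y Z (g : hom Y Z) (f : hom X Y) : (- g) \oc f = - (g \oc f).
Proof. by apply: (addrI (g \oc f)); rewrite -hcompDl !subrr comp0m. Qed.

Lemma compmN X Y Z (g : hom Y Z) (f : hom X Y) : g \oc (- f) = - (g \oc f).
Proof. by apply: (addrI (g \oc f)); rewrite -hcompDr !subrr compm0. Qed.

Lemma compmB X Y Z (g : hom Y Z) (f f' : hom X Y) :
  g \oc (f - f') = (g \oc f) - (g \oc f').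
Proof. by rewrite hcompDr compmN. Qed.

Lemma compBm X Y Z (g g' : hom Y Z) (f : hom X Y) :
  (g - g') \oc f = (g \oc f) - (g' \oc f).
Proof. by rewrite hcompDl compNm. Qed.

Lemma is_iso_idm X : is_iso (idm X).
Proof. by exists (idm X); rewrite hcomp1m. Qed.

Lemma is_iso_oppm X : is_iso (- idm X).
Proof. by exists (- idm X); rewrite compNm compmN opprK hcomp1m. Qed.

Lemma iso_refl X : iso_obj X X.
Proof. by exists (idm X); exact: is_iso_idm. Qed.

Lemma iso_sym X Y : iso_obj X Y -> iso_obj Y X.
Proof. by case=> f [g [gf fg]]; exists g, f. Qed.

Lemma iso_trans Y X Z : iso_obj X Y -> iso_obj Y Z -> iso_obj X Z.
Proof.
case=> f [g [gf fg]] [f' [g' [gf' fg']]]; exists (f' \oc f), (g \oc g').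
split; first by rewrite -hcompA (hcompA g') gf' hcomp1m.
by rewrite -hcompA (hcompA f) fg hcomp1m.
Qed.

Definition nohom X Y : Prop := forall f : hom X Y, f = 0.

Lemma nohom_iso X X' Y Y' :
  iso_obj X X' -> iso_obj Y Y' -> nohom X Y -> nohom X' Y'.
Proof.
case=> a [b [ba ab]] [c [e [ec ce]]] XY f.
rewrite -(hcomp1m f) -(hcompm1 f) -ab -ce.
have -> : c \oc e \oc (f \oc (a \oc b)) = c \oc (e \oc f \oc a) \oc b.
  by rewrite !hcompA.
by rewrite (XY (_ \oc a)) compm0 comp0m.
Qed.

Lemma nohom_iso_iff X X' Y Y' :
  iso_obj X X' -> iso_obj Y Y' -> nohom X Y <-> nohom X' Y'.
Proof. by move=> XX YY; split; apply: nohom_iso => //; exact: iso_sym. Qed.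

Lemma is_zero_nohomr Z X : is_zero Z -> nohom X Z.
Proof. by move=> Z0 f; rewrite -(hcomp1m f) Z0 comp0m. Qed.

Lemma is_dsum1 X : is_dsum (fun _ : 'I_1 => X) X.
Proof.
exists (fun _ => idm X), (fun _ => idm X); split => [k|j k|].
- exact: hcomp1m.
- by rewrite !ord1 eqxx.
- by rewrite big_ord_recl big_ord0 addr0 hcomp1m.
Qed.

Lemma subcategory_summand (A : set C) S Y :
  subcategory A -> A S -> is_summand Y S -> A Y.
Proof.
move=> EA AS YS; rewrite EA; exists 1%N, (fun=> S), S.
by split => //; exact: is_dsum1.
Qed.

End Preadditive.

(** * Integer powers of the shift and exactness properties of triangles *)

Section Triangulated.
Variable D : triangulated.
Implicit Types (X Y Z W : D) (i j : int).

Local Notation sht X := (@shift D X).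
Local Notation shn n X := (iter n (@shift D) X).


Lemma exists_zero : exists Z : D, is_zero Z.
Proof.
have F : 'I_0 -> D by case.
have [Z [inj [prj [_ _ sum1]]]] := tcat_additive F.
by exists Z; rewrite /is_zero -sum1 big_ord0.
Qed.

Lemma shiftm_surj X Y (f : hom (sht X) (sht Y)) : exists g, shiftm g = f.
Proof. by have [g _ gK] := @shiftm_bij D X Y; exists (g f). Qed.

Lemma shiftm_inj X Y : injective (@shiftm D X Y).
Proof. exact: bij_inj (shiftm_bij X Y). Qed.

Lemma shiftm0 X Y : shiftm (0 : hom X Y) = 0.
Proof. by apply: (addrI (shiftm 0)); rewrite -shiftmD !addr0. Qed.

Lemma shift_iso X Y : iso_obj X Y -> iso_obj (sht X) (sht Y).
Proof.
case=> f [g [gf fg]]; exists (shiftm f), (shiftm g).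
by rewrite -!shiftm_comp gf fg !shiftm1.
Qed.

Lemma shift_iso_inv X Y : iso_obj (sht X) (sht Y) -> iso_obj X Y.
Proof.
case=> f [g [gf fg]]; have [f' Ef] := shiftm_surj f.
have [g' Eg] := shiftm_surj g; exists f', g'.
by split; apply: shiftm_inj; rewrite shiftm_comp Ef Eg shiftm1.
Qed.

Lemma nohom_shift X Y : nohom (sht X) (sht Y) <-> nohom X Y.
Proof.
split=> XY f; first by apply: shiftm_inj; rewrite shiftm0.
by have [g <-] := shiftm_surj f; rewrite (XY g) shiftm0.
Qed.

Lemma nohom_shn n X Y : nohom (shn n X) (shn n Y) <-> nohom X Y.
Proof. by elim: n => //= n <-; exact: nohom_shift. Qed.

Fixpoint shiftnm (n : nat) X Y (f : hom X Y) : hom (shn n X) (shn n Y) :=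
  if n is m.+1 then shiftm (shiftnm m f) else f.

Lemma shiftnm1 n X : shiftnm n (idm X) = idm (shn n X).
Proof. by elim: n => //= n ->; rewrite shiftm1. Qed.

Lemma shiftnm_comp n X Y Z (g : hom Y Z) (f : hom X Y) :
  shiftnm n (g \oc f) = shiftnm n g \oc shiftnm n f.
Proof. by elim: n => //= n ->; rewrite shiftm_comp. Qed.

Lemma shiftnmD n X Y (f g : hom X Y) :
  shiftnm n (f + g) = shiftnm n f + shiftnm n g.
Proof. by elim: n => //= n ->; rewrite shiftmD. Qed.

Lemma shiftnm0 n X Y : shiftnm n (0 : hom X Y) = 0.
Proof. by elim: n => //= n ->; rewrite shiftm0. Qed.

Lemma shiftnm_surj n X Y (f : hom (shn n X) (shn n Y)) :
  exists g, shiftnm n g = f.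
Proof.
elim: n f => [|n IHn] f; first by exists f.
have [f' <-] := shiftm_surj f; have [g <-] := IHn f'.
by exists g.
Qed.

Lemma shn_iso n X Y : iso_obj X Y -> iso_obj (shn n X) (shn n Y).
Proof. by move=> XY; elim: n => //= n; exact: shift_iso. Qed.

(** Only an isomorphism: [unshift] inverts [shift] on objects merely up to isomorphism. *)
Lemma sh_succ i X : iso_obj (sh (i + 1) X) (sht (sh i X)).
Proof.
case: i => [n|[|n]].
- by rewrite (_ : Posz n + 1 = Posz n.+1); [exact: iso_refl|lia].
- by rewrite (_ : Negz 0 + 1 = Posz 0); [exact/iso_sym/unshiftK|lia].
- rewrite (_ : Negz n.+1 + 1 = Negz n); [exact/iso_sym/unshiftK|lia].
Qed.

Lemma sh_pred i X : iso_obj (sht (sh (i - 1) X)) (sh i X).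
Proof. by apply: iso_sym; have := sh_succ (i - 1) X; rewrite subrK. Qed.

Lemma sh_comp i j X : iso_obj (sh i (sh j X)) (sh (i + j) X).
Proof.
elim: i => [|n IHn|n IHn]; first by rewrite add0r; exact: iso_refl.
- rewrite (_ : Posz n.+1 + j = Posz n + j + 1); last by lia.
  apply: iso_trans (iso_sym (sh_succ _ _)).
  exact: shift_iso IHn.
- apply: shift_iso_inv.
  apply: (iso_trans (Y := sh (- Posz n) (sh j X))).
    by have := sh_pred (- Posz n) (sh j X); congr (iso_obj (sht (sh _ _)) _); lia.
  apply: iso_trans IHn _; apply: iso_sym.
  by have := sh_pred (- Posz n + j) X; congr (iso_obj (sht (sh _ _)) _); lia.
Qed.

(** [unshift] does not act on morphisms, so for a negative shift the isomorphism is read after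
    shifting both sides back, and the shifts are then cancelled. *)
Lemma sh_iso i X Y : iso_obj X Y -> iso_obj (sh i X) (sh i Y).
Proof.
case: i => n XY; first exact: shn_iso.
have shV Z : iso_obj (shn n.+1 (sh (Negz n) Z)) Z.
  have := sh_comp (Posz n.+1) (Negz n) Z.
  by rewrite (_ : Posz n.+1 + Negz n = 0) //; lia.
have {}XY := iso_trans (shV X) (iso_trans XY (iso_sym (shV Y))).
elim: (n.+1) XY => //= m IHm /shift_iso_inv; exact: IHm.
Qed.

Definition ext0 X Y i : Prop := nohom X (sh i Y).

(** Balancing the degree between the two arguments leaves only non-negative shifts, where [shiftnm]
    acts on morphisms and triangles. *)
Lemma ext0_shn (l k : nat) i X Y : k%:Z - l%:Z = i ->
  ext0 X Y i <-> nohom (shn l X) (shn k Y).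
Proof.
move=> <-; rewrite /ext0 -(nohom_shn l).
apply: nohom_iso_iff; first exact: iso_refl.
apply: iso_trans (sh_comp (Posz l) _ _) _.
by rewrite addrC subrK; exact: iso_refl.
Qed.

Lemma ext0_iso X X' Y Y' i :
  iso_obj X X' -> iso_obj Y Y' -> ext0 X Y i -> ext0 X' Y' i.
Proof. by move=> XX YY; apply: nohom_iso => //; exact: sh_iso. Qed.

Lemma ext0_shr i j X Y : ext0 X (sh j Y) i <-> ext0 X Y (i + j).
Proof. by apply: nohom_iso_iff; [exact: iso_refl|exact: sh_comp]. Qed.

Lemma int_shifts i : exists l k : nat, k%:Z - l%:Z = i.
Proof.
by case: i => n; [exists 0%N, n | exists n.+1, 0%N]; lia.
Qed.

Lemma ext0_shl (n : nat) i X Y : ext0 (shn n X) Y i <-> ext0 X Y (i - n%:Z).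
Proof.
have [l [k Ei]] := int_shifts i.
rewrite (ext0_shn _ _ Ei) (@ext0_shn (l + n) k); last by lia.
by rewrite iterD.
Qed.

Lemma ext0_zero X Y i : is_zero Y -> ext0 X Y i.
Proof.
move=> Y0; have [l [k Ei]] := int_shifts i; apply/(ext0_shn _ _ Ei).
by apply: is_zero_nohomr; rewrite /is_zero -shiftnm1 Y0 shiftnm0.
Qed.

(* Three rotations negate all three maps; two of the signs are absorbed by an
   isomorphism of triangles. *)
Lemma dist_shift X Y Z (f : hom X Y) (g : hom Y Z) (h : hom Z (sht X)) :
  dist f g h -> dist (shiftm f) (shiftm g) (- shiftm h).
Proof.
move=> /dist_rot/dist_rot/dist_rot fgh.
apply: dist_iso (is_iso_idm _) (is_iso_oppm _) (is_iso_idm _) _ _ _ fgh.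
- by rewrite hcompm1 compNm compmN opprK hcomp1m.
- by rewrite hcomp1m compmN hcompm1.
- by rewrite shiftm1 hcomp1m hcompm1.
Qed.

Lemma dist_shn n X Y Z (f : hom X Y) (g : hom Y Z) (h : hom Z (sht X)) :
  dist f g h -> exists h', dist (shiftnm n f) (shiftnm n g) h'.
Proof.
move=> fgh; elim: n => [|n [h' /dist_shift fgh']]; first by exists h.
by eexists; exact: fgh'.
Qed.

(** The rotated triangle on [idm W] maps to the rotated given triangle with first component [u]; the
    third component, desuspended, is the lift. *)
Lemma dist_lift W X Y Z (f : hom X Y) (g : hom Y Z) (h : hom Z (sht X))
    (u : hom W Y) : dist f g h -> g \oc u = 0 -> exists v, f \oc v = u.
Proof.
move=> /dist_rot fgh gu.
have [O O0] := exists_zero.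
have /dist_rot idW := dist_id W O0.
have [|c [_]] := dist_mor (a := u) (b := (0 : hom O Z)) idW fgh.
  by rewrite comp0m gu.
rewrite shiftm1 compmN hcompm1 compNm => /oppr_inj.
have [v <-] := shiftm_surj c; rewrite -shiftm_comp => /shiftm_inj ->.
by exists v.
Qed.

Lemma dist_extend W X Y Z (f : hom X Y) (g : hom Y Z) (h : hom Z (sht X))
    (u : hom Y W) : dist f g h -> u \oc f = 0 -> exists v, v \oc g = u.
Proof.
move=> fgh uf.
have [O O0] := exists_zero.
have idW : dist (0 : hom O W) (idm W) 0.
  apply/dist_rot; rewrite shiftm0 oppr0.
  by apply: dist_id; rewrite /is_zero -shiftm1 O0 shiftm0.
have [|c [cg _]] := dist_mor (a := (0 : hom X O)) (b := u) fgh idW.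
  by rewrite comp0m uf.
by exists c; rewrite cg hcomp1m.
Qed.

Lemma dist_comp0 X Y Z (f : hom X Y) (g : hom Y Z) (h : hom Z (sht X)) :
  dist f g h -> g \oc f = 0.
Proof.
move=> fgh; have [O O0] := exists_zero.
have [c [cg _]] := dist_mor (a := idm X) (b := f) (dist_id X O0) fgh erefl.
by rewrite -cg compm0.
Qed.

Lemma dist_fiber Y Z C (f : hom Y Z) (g : hom Z C) (h : hom C (sht Y)) :
  dist f g h -> exists X (a : hom X Y) (b : hom Z (sht X)),
    dist a f b /\ iso_obj C (sht X).
Proof.
move=> fgh; have [e [e' [e'e ee']]] := iso_sym (unshiftK C).
set X := unshift C in e e' e'e ee' *.
(* The sign cancels the one that [dist_rot] puts on the shifted first map. *)
have [a Ea] := shiftm_surj (- (h \oc e')).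
exists X, a, (e \oc g); split; last by exists e, e'.
apply/dist_rot; rewrite Ea opprK.
have e_iso : is_iso e by exists e'.
apply: dist_iso (is_iso_idm _) (is_iso_idm _) e_iso _ _ _ fgh.
- by rewrite hcompm1 hcomp1m.
- by rewrite hcompm1.
- by rewrite shiftm1 hcomp1m -hcompA e'e hcompm1.
Qed.

Lemma dist_rotate X Y Z (f : hom X Y) (g : hom Y Z) (h : hom Z (sht X)) :
  dist f g h -> dist g h (- shiftm f).
Proof. by move/dist_rot. Qed.

(** * Long exact sequences, as statements about the vanishing of [Hom(X, Y[i])] *)

Section LongExact.
Variables (X Y Z : D) (f : hom X Y) (g : hom Y Z) (h : hom Z (sht X)).
Hypothesis fgh : dist f g h.

Lemma ext0_mid W i : ext0 W X i -> ext0 W Z i -> ext0 W Y i.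
Proof.
have [l [k Ei]] := int_shifts i; rewrite !(ext0_shn _ _ Ei) => WX WZ u.
have [h' fgh'] := dist_shn k fgh.
by have [|v <-] := dist_lift (u := u) fgh'; rewrite ?WZ // (WX v) compm0.
Qed.

Lemma ext0_midl W i : ext0 X W i -> ext0 Z W i -> ext0 Y W i.
Proof.
have [l [k Ei]] := int_shifts i; rewrite !(ext0_shn _ _ Ei) => XW ZW u.
have [h' fgh'] := dist_shn l fgh.
by have [|v <-] := dist_extend (u := u) fgh'; rewrite ?XW // (ZW v) comp0m.
Qed.

End LongExact.

Lemma ext0_shiftr X Y i : ext0 X (sht Y) i <-> ext0 X Y (i + 1).
Proof. exact: (ext0_shr i 1). Qed.

Lemma ext0_shiftl X Y i : ext0 (sht X) Y i <-> ext0 X Y (i - 1).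
Proof. exact: (ext0_shl 1). Qed.

Section LongExactRotated.
Variables (X Y Z : D) (f : hom X Y) (g : hom Y Z) (h : hom Z (sht X)).
Hypothesis fgh : dist f g h.

Lemma ext0_right W i : ext0 W Y i -> ext0 W X (i + 1) -> ext0 W Z i.
Proof.
move=> WY WX; apply: (ext0_mid (dist_rotate fgh)) WY _.
exact: (ext0_shiftr _ _ _).2 WX.
Qed.

Lemma ext0_left W i : ext0 W Z (i - 1) -> ext0 W Y i -> ext0 W X i.
Proof.
rewrite -{2 3}(subrK 1 i) => WZ WY; apply: (ext0_shiftr _ _ _).1.
apply: (ext0_mid (dist_rotate (dist_rotate fgh))) WZ _.
exact: (ext0_shiftr _ _ _).2 WY.
Qed.

Lemma ext0_leftl W i : ext0 Y W i -> ext0 Z W (i + 1) -> ext0 X W i.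
Proof.
rewrite -{1 3}(addrK 1 i) => YW ZW; apply: (ext0_shiftl _ _ _).1.
apply: (ext0_midl (dist_rotate (dist_rotate fgh))) ZW _.
exact: (ext0_shiftl _ _ _).2 YW.
Qed.

Lemma ext0_rightl W i : ext0 X W (i - 1) -> ext0 Y W i -> ext0 Z W i.
Proof.
move=> XW YW; apply: (ext0_midl (dist_rotate fgh)) YW _.
exact: (ext0_shiftl _ _ _).2 XW.
Qed.

(** Surjectivity of [Hom(W, f)] forces [Hom(W, g)] to be zero, so [Hom(W, Z)] embeds into [Hom(W,
    X[1])]. It is applied with [f] a right approximation. *)
Lemma nohom_cone W : (forall u : hom W Y, exists v, f \oc v = u) ->
  nohom W (sht X) -> nohom W Z.
Proof.
move=> lift WX u; have gh := dist_rotate fgh.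
have [|v <-] := dist_lift (u := u) gh; first exact: WX.
have [w <-] := lift v.
by rewrite hcompA (dist_comp0 fgh) comp0m.
Qed.

Lemma split_dsum : h = 0 -> is_dsum (fun b : bool => if b then X else Z) Y.
Proof.
move=> h0; have fgh' := fgh; rewrite h0 in fgh'.
have [|s gs] := dist_lift (u := idm Z) (dist_rotate fgh').
  by rewrite comp0m.
have gf := dist_comp0 fgh'.
(* A map killed by [f] factors, after one shift, through [h], which is zero. *)
have f_mono W (u : hom W X) : f \oc u = 0 -> u = 0.
  move=> fu; apply: shiftm_inj; rewrite shiftm0.
  have [|v <-] := dist_lift (u := shiftm u)
    (dist_rotate (dist_rotate fgh')).
    by rewrite compNm -shiftm_comp fu shiftm0 oppr0.
  by rewrite comp0m.
have [|r fr] := dist_lift (u := idm Y - (s \oc g)) fgh'.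
  by rewrite compmB hcompm1 hcompA gs hcomp1m subrr.
have rf : r \oc f = idm X.
  apply/eqP; rewrite -subr_eq0; apply/eqP/f_mono.
  by rewrite compmB hcompA fr compBm hcomp1m -hcompA gf compm0 subr0 hcompm1 subrr.
have rs : r \oc s = 0.
  by apply: f_mono; rewrite hcompA fr compBm hcomp1m -hcompA gs hcompm1 subrr.
exists (fun b => if b return hom (if b then X else Z) Y then f else s).
exists (fun b => if b return hom Y (if b then X else Z) then r else g).
split=> [[]|[] []|] //.
by rewrite big_bool /= fr subrK.
Qed.

Lemma split_right : h = 0 -> is_summand Z Y.
Proof.
(* [is_summand] places its summand at [true], so the two indices are exchanged. *)
move=> /split_dsum [inj [prj [pi pj sum1]]]; exists X.
exists (fun b => if b return hom (if b then Z else X) Y then inj false else inj true).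
exists (fun b => if b return hom Y (if b then Z else X) then prj false else prj true).
split; first by case; [exact: pi false|exact: pi true].
  by case=> [] [] //= _; [exact: pj false true _|exact: pj true false _].
by rewrite -sum1 !big_bool /= addrC.
Qed.

Lemma split_left : h = 0 -> is_summand X Y.
Proof. by move=> /split_dsum ?; exists Z. Qed.

End LongExactRotated.

End Triangulated.

(** * Classes cut out by vanishing conditions, and the halves of the t-structure *)

Section Orthogonals.
Variable D : triangulated.
Implicit Types (X Y W S : D) (A P : set D) (i j q : int).

Lemma ext0_dsum (I : finType) (F : I -> D) S W i :
  is_dsum F S -> (forall a, ext0 W (F a) i) -> ext0 W S i.
Proof.
case=> inj [prj [_ _ sum1]] WF.
have [l [k Ei]] := int_shifts i; apply: (ext0_shn _ _ Ei).2 => u.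
rewrite -(hcomp1m u) -shiftnm1 -sum1.
rewrite (big_morph _ (@shiftnmD D k S S) (@shiftnm0 D k S S)).
rewrite (big_morph (fun v => v \oc u) (fun v w => hcompDl v w u) (comp0m _ u)).
apply: big1 => a _; rewrite shiftnm_comp -hcompA.
by rewrite ((ext0_shn _ _ Ei).1 (WF a) (_ \oc u)) compm0.
Qed.

Lemma ext0_summand Y S W i : is_summand Y S -> ext0 W S i -> ext0 W Y i.
Proof.
case=> Y' [inj [prj [pi _ _]]].
have [l [k Ei]] := int_shifts i => WS; apply: (ext0_shn _ _ Ei).2 => u.
rewrite -(hcomp1m u) -shiftnm1 -(pi true) shiftnm_comp -hcompA.
by rewrite ((ext0_shn _ _ Ei).1 WS (_ \oc u)) compm0.
Qed.

Lemma is_summand_iso X Y : iso_obj X Y -> is_summand X Y.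
Proof.
case=> f [g [gf fg]]; have [O O0] := exists_zero D; exists O.
exists (fun b => if b return hom (if b then X else O) Y then f else 0).
exists (fun b => if b return hom Y (if b then X else O) then g else 0).
split; first by case=> //; rewrite O0 comp0m.
  by case=> [] [] // _; rewrite ?comp0m ?compm0.
by rewrite big_bool /= fg comp0m addr0.
Qed.

(** A common form for the torsion and torsion-free classes below, whose closure under sums and
    summands is thereby proved once. *)
Definition ext_orth (J : D -> int -> Prop) : set D :=
  [set Y | forall W i, J W i -> ext0 W Y i].

Lemma ext_orth_subcategory J : subcategory (ext_orth J).
Proof.
apply/seteqP; split => [Y JY | Y [n [F [S [JF FS YS]]]] W i JWi].
  exists 1%N, (fun=> Y), Y; split => //; first exact: is_dsum1.
  exact/is_summand_iso/iso_refl.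
by apply: ext0_summand YS _; apply: ext0_dsum FS _ => a; exact: JF.
Qed.

(* For [A = P] these are D^{<=q} and D^{>=q}. *)
Definition ext_le A q : set D :=
  [set Y | forall W i, A W -> q < i -> ext0 W Y i].

Definition ext_ge A q : set D :=
  [set Y | forall W i, A W -> i < q -> ext0 W Y i].

Lemma ext_le_sh A q j Y : ext_le A q (sh j Y) <-> ext_le A (q + j) Y.
Proof.
split=> AY W i AW qi; last by apply: (ext0_shr _ _ _ _).2; apply: AY => //; lia.
have -> : i = i - j + j by lia.
by apply: (ext0_shr _ _ _ _).1; apply: AY => //; lia.
Qed.

Lemma ext_ge_sh A q j Y : ext_ge A q (sh j Y) <-> ext_ge A (q + j) Y.
Proof.
split=> AY W i AW qi; last by apply: (ext0_shr _ _ _ _).2; apply: AY => //; lia.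
have -> : i = i - j + j by lia.
by apply: (ext0_shr _ _ _ _).1; apply: AY => //; lia.
Qed.

Lemma ext_le_iso A q X Y : iso_obj X Y -> ext_le A q X -> ext_le A q Y.
Proof.
by move=> XY AX W i AW qi; apply: ext0_iso (iso_refl W) XY _; exact: AX.
Qed.

Lemma ext_ge_iso A q X Y : iso_obj X Y -> ext_ge A q X -> ext_ge A q Y.
Proof.
by move=> XY AX W i AW qi; apply: ext0_iso (iso_refl W) XY _; exact: AX.
Qed.

Lemma sh_cancel i X : iso_obj X (sh (- i) (sh i X)).
Proof. by apply: iso_sym; have := sh_comp (- i) i X; rewrite addNr. Qed.

Lemma Dle0E P : Dle0 P = ext_le P 0.
Proof.
apply/seteqP; split=> [Y PY W i PW i_gt0 | Y PY i i_gt0 W Z PW ->].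
  exact: PY i i_gt0 W Y PW erefl.
exact: PY.
Qed.

Lemma Dge0E P : Dge0 P = ext_ge P 0.
Proof.
apply/seteqP; split=> [Y PY W i PW i_gt0 | Y PY i i_gt0 W Z PW ->].
  exact: PY i i_gt0 W Y PW erefl.
exact: PY.
Qed.

Lemma DleE P q : Dle P q = ext_le P q.
Proof.
rewrite /Dle Dle0E; apply/seteqP; split=> [Y [Y' PY' /iso_sym YY']|Y PY].
  by apply: ext_le_iso YY' _; apply/ext_le_sh; rewrite subrr.
by exists (sh q Y); [apply/ext_le_sh; rewrite add0r | exact: sh_cancel].
Qed.

Lemma DgeE P q : Dge P q = ext_ge P q.
Proof.
rewrite /Dge Dge0E; apply/seteqP; split=> [Y [Y' PY' /iso_sym YY']|Y PY].
  by apply: ext_ge_iso YY' _; apply/ext_ge_sh; rewrite subrr.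
by exists (sh q Y); [apply/ext_ge_sh; rewrite add0r | exact: sh_cancel].
Qed.

Lemma dHE P d : dH P d = ext_le P 0 `&` ext_ge P (1 - d%:Z).
Proof. by rewrite /dH /Dint DleE DgeE addrC. Qed.

Lemma ext_ge_mono A q j : q <= j -> ext_ge A j `<=` ext_ge A q.
Proof. by move=> qj Y AY W i AW ji; apply: AY => //; lia. Qed.

End Orthogonals.

(** * Orthogonality and truncation for the t-structure in arbitrary position *)

Section Truncation.
Variables (D : triangulated) (P : set D).
Hypothesis P_tstr : tstructure (Dle0 P) (Dge0 P).
Implicit Types (X Y : D) (i q : int).

Lemma tstr_ext0 X Y i q : ext_le P 0 X -> ext_ge P q Y -> i < q -> ext0 X Y i.
Proof.
move=> PX PY iq.
have : ext0 X (sh (i + 1) Y) (- 1).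
  apply: (tstr_hom0 P_tstr); first by rewrite Dle0E.
  by rewrite Dge0E; apply/ext_ge_sh; apply: ext_ge_mono PY; lia.
by move/(ext0_shr _ _ _ _).1; congr (ext0 _ _ _); lia.
Qed.

(** The t-structure triangle of [X[-n]] is shifted back by [n], a natural number so that the shift
    acts on the maps too. *)
Lemma truncation (n : nat) X : exists W F (f : hom W X) (g : hom X F) h,
  [/\ ext_le P (- n%:Z) W, ext_ge P (1 - n%:Z) F & dist f g h].
Proof.
have [W [F [f [g [h []]]]]] := tstr_tri P_tstr (sh (- n%:Z) X).
rewrite Dle0E Dge0E => PW PF fgh.
have [h' fgh'] := dist_shn n fgh.
have [e e_iso] : iso_obj (sh n (sh (- n%:Z) X)) X.
  by have := sh_comp n (- n%:Z) X; rewrite subrr.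
have [e' [e'e ee']] := e_iso.
exists (sh n W), (sh n (sh (- 1) F)), (e \oc shiftnm n f), (shiftnm n g \oc e'), h'.
split; first by apply/ext_le_sh; rewrite addNr.
  by do 2!apply/ext_ge_sh; apply: ext_ge_mono PF; lia.
apply: dist_iso (is_iso_idm _) e_iso (is_iso_idm _) _ _ _ fgh'.
- by rewrite hcompm1.
- by rewrite hcomp1m -hcompA e'e hcompm1.
- by rewrite shiftm1 hcomp1m hcompm1.
Qed.

End Truncation.

(** * Comparison of the degree bounds given by [P] and by [M] *)

Section Tilting.
Variables (D : triangulated) (P : set D) (d : nat).
Hypothesis P_tstr : tstructure (Dle0 P) (Dge0 P).
Hypothesis P_sub : P `<=` dH P d.
Variable M : set D.
Hypothesis M_tilting : tilting (dH P d) P d M.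
Hypothesis M_cf : contravariantly_finite M (dH P d).
Implicit Types (X Y Z m p : D) (i q : int).

Local Notation H := (dH P d).
Local Notation shn n X := (iter n (@shift D) X).

Lemma heart_le X : H X -> ext_le P 0 X.
Proof. by rewrite dHE => -[]. Qed.

Lemma heart_ge X : H X -> ext_ge P (1 - d%:Z) X.
Proof. by rewrite dHE => -[]. Qed.

Lemma tilting_sub : M `<=` H.
Proof. by case: M_tilting => -[]. Qed.

Lemma tilting_subcategory : subcategory M.
Proof. by case: M_tilting => -[]. Qed.

Lemma tilting_le X : M X -> ext_le M 0 X.
Proof.
by move=> MX W i MW i_gt0; case: M_tilting => _ _ /(_ i i_gt0 W X MW MX).
Qed.

(** Each of the at most [d] syzygies of an object of [M] costs one degree. The induction descends
    from the [d]-th syzygy, which lies in [P]; [j] counts the steps from it. *)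
Lemma ext_le_heart_tilting q X : ext_le P q X -> ext_le M (d%:Z + q) X.
Proof.
move=> PX m k Mm; have [_ /(_ m Mm) [Z [Q [<- PZd res]]] _ _] := M_tilting.
suff {m Mm} claim j : forall n, (n + j = d)%N -> forall k, j%:Z + q < k -> ext0 (Z n) X k.
  by apply: claim; rewrite add0n.
elim: j => [|j IHj] n nj {}k qk.
  by move: nj PZd; rewrite addn0 => -> PZd; apply: PX => //; lia.
have [PQ [f [g [h [_ _ _ fgh]]]]] := res n.+1 isT.
apply: (ext0_rightl fgh); first by apply: IHj; lia.
by apply: PX => //; lia.
Qed.

Definition coresolution p r (Y N : nat -> D) : Prop :=
  [/\ Y 0%N = p, M (Y r) & forall n : nat, (1 <= n <= r)%N ->
    M (N n.-1) /\ extriangle H (Y n.-1) (N n.-1) (Y n)].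

(** Descending induction from [Y r]: going back to [Y n.-1] uses vanishing for [Y n] one degree
    higher, so the bound [q] is never weakened. *)
Lemma coresolution_ext0 p r (Y N : nat -> D) q X : coresolution p r Y N ->
  ext_le M q X -> forall n, (n <= r)%N -> forall k, q < k -> ext0 (Y n) X k.
Proof.
move=> [_ MYr cores] MX n nr; rewrite -(subKn nr).
elim: (r - n)%N => [|j IHj] k qk; first by rewrite subn0; exact: MX.
have [rj|jr] := leqP r j.
  by rewrite (_ : r - j.+1 = r - j)%N; [exact: IHj|lia].
have Ej : (r - j.+1 = (r - j).-1)%N by lia.
have [|MN [f [g [h [_ _ _ fgh]]]]] := cores (r - j)%N; first by lia.
rewrite Ej; apply: (ext0_leftl fgh); first exact: MX.
by apply: IHj; lia.
Qed.

Lemma ext_le_tilting_heart q X : ext_le M q X -> ext_le P q X.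
Proof.
move=> MX p k Pp qk; have [_ _ _ /(_ p Pp) [r [Y [N cores]]]] := M_tilting.
have [<- _ _] := cores.
exact: coresolution_ext0 cores MX _ _ _ qk.
Qed.

(* Since objects of M have projective dimension at most d, the d-th step of a
   longer coresolution splits. *)
Lemma coresolution_bounded p : P p ->
  exists r (Y N : nat -> D), coresolution p r Y N /\ (r <= d)%N.
Proof.
move=> Pp; have [_ _ _ /(_ p Pp) [r [Y [N cores]]]] := M_tilting.
have [rd|dr] := leqP r d; first by exists r, Y, N.
exists d, Y, N; split=> //; have [Y0 MYr res] := cores.
split=> // [|n nd]; last by apply: res; lia.
have [|/= MN [f [g [h [_ _ _ fgh]]]]] := res d.+1; first by lia.
apply: subcategory_summand tilting_subcategory MN _.
apply: (split_left fgh).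
suff : ext0 (Y d.+1) (Y d) 1 by exact.
(* The obstruction to splitting is carried back along the coresolution to [Hom(Y_{d+1}, p[d+1])],
   just above the bound [d] valid for objects of the heart. *)
suff claim n : (n <= d)%N -> ext0 (Y d.+1) (Y n) (d%:Z - n%:Z + 1).
  by have := claim d (leqnn d); rewrite subrr.
elim: n => [_|n IHn nd].
  have PY0 : ext_le P 0 (Y 0%N) by rewrite Y0; exact/heart_le/P_sub.
  by apply: coresolution_ext0 cores (ext_le_heart_tilting PY0) _ dr _ _; lia.
have [|/= MNn [f' [g' [h' [_ _ _ fgh']]]]] := res n.+1; first by lia.
apply: (ext0_right fgh').
  by apply: coresolution_ext0 cores (tilting_le MNn) _ dr _ _; lia.
rewrite (_ : _ + 1 = d%:Z - n%:Z + 1); last by lia.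
by apply: IHn; lia.
Qed.

(** * The class [T], its equality with [Fac_d(M)], and the objects it contains *)

Definition tilting_perp : set D := H `&` ext_le M 0.
Local Notation T := tilting_perp.

Lemma tilting_perp_sub : M `<=` T.
Proof. by move=> X MX; split; [exact: tilting_sub|exact: tilting_le]. Qed.

Lemma tilting_perp_resolve X : T X -> exists Z N, [/\ T Z, M N & extriangle H Z N X].
Proof.
move=> [HX MX]; have [N [g [MN gN]]] := M_cf HX.
have [C [c [h ghc]]] := dist_cone g.
have [Z [f [h' [fgh CZ]]]] := dist_fiber ghc.
have MZ : ext_le M 0 Z.
  move=> m k Mm k_gt0; have [k_gt1|k1] : 1 < k \/ k = 1 by lia.
    apply: (ext0_left fgh); first by apply: MX => //; lia.
    by apply: tilting_le => //; lia.
  (* Degree 1 is where the approximation property enters: every map from [m] to [X] lifts to [N]. *)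
  rewrite k1; apply: nohom_cone (dist_rotate fgh) _ _ _.
    by move=> u; have [v <-] := gN _ u Mm; exists v.
  exact: (tilting_le MN Mm (i := 1)).
have HZ : H Z.
  rewrite dHE; split; first exact: ext_le_tilting_heart.
  move=> p k Pp kd; apply: (ext0_left fgh); first by apply: (heart_ge HX) => //; lia.
  exact: (heart_ge (tilting_sub MN)).
exists Z, N; split => //; exists f, g, h'; split => //.
exact: tilting_sub.
Qed.

(** From left to right, [Z n] has no [M]-cohomology above degree [n]: this holds for [n = d], as for
    every object of the heart, and descends to [n = 0]. Conversely, resolving by approximations
    stays inside [T] and can be repeated any number of times. *)
Lemma Fac_tilting : Fac H d M = T.
Proof.
apply/seteqP; split=> [Z0 [HZ [Z [N [EZ res]]]] | ].
  split => // m k Mm k_gt0; rewrite -{}EZ in HZ *.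
  suff claim j : forall n, (n + j = d)%N -> forall k, n%:Z < k -> ext0 m (Z n) k.
    by apply: (claim d); rewrite ?add0n.
  elim: j => [|j IHj] n nj {k_gt0}k nk.
    have HZn : H (Z n).
      case: n nj {nk} => [//|n nj].
      by have [|_ [f [g [h []]]]] := res n.+1; first by lia.
    by apply: (ext_le_heart_tilting (heart_le HZn)) => //; lia.
  have [|MN [f [g [h [_ _ _ fgh]]]]] := res n.+1; first by lia.
  apply: (ext0_right fgh); first by apply: (tilting_le MN) => //; lia.
  by apply: IHj; lia.
suff TFac s : T `<=` Fac H s M by exact: TFac.
elim: s => [|s IHs] X TX.
  by split; [case: TX | exists (fun=> X), (fun=> X); split => // n; lia].
have [Z [N [TZ MN ZNX]]] := tilting_perp_resolve TX.
have [_ [Zs [Ns [EZ res]]]] := IHs Z TZ.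
split; first by case: TX.
(* The new extriangle is prepended. [Fac] reads middle terms from index 1 on, so the value of the
   second sequence at 0 is a filler. *)
exists (fun n => if n is n'.+1 then Zs n' else X).
exists (fun n => if n is n'.+2 then Ns n'.+1 else N).
split => // -[|[|n]] // ns; first by rewrite EZ.
by apply: res; lia.
Qed.

Lemma tilting_perp_projective X :
  T X -> (forall Z, T Z -> ext0 X Z 1) -> M X.
Proof.
move=> TX XT; have [Z [N [TZ MN [f [g [h [_ _ _ fgh]]]]]]] := tilting_perp_resolve TX.
apply: subcategory_summand tilting_subcategory MN _.
by apply: (split_right fgh); exact: XT.
Qed.

(** Injectivity gives degree 1; higher degrees reduce to it along the syzygies of [m], because
    [Hom(P, I[k])] vanishes for positive [k]. *)
Lemma Einjective_tilting_perp : Einjective H `<=` T.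
Proof.
move=> I [HI injI]; split=> // m k Mm k_gt0.
have [_ /(_ m Mm) [Z [Q [<- _ res]]] _ _] := M_tilting.
have -> : k = (`|k|.-1)%N%:Z + 1 by lia.
(* The syzygy index, initially 0, is generalised: each step lowers the degree and passes to the next
   syzygy. *)
elim: (`|k|.-1)%N 0%N => [|n IHn] j.
  have [_ [f [g [h [_ _ HZ _]]]]] := res j.+1 isT.
  exact: injI _ _ HZ erefl.
have [PQ [f [g [h [_ _ _ fgh]]]]] := res j.+1 isT.
apply: (ext0_rightl fgh); last by apply: (heart_le HI) => //; lia.
rewrite (_ : _ - 1 = n%:Z + 1); first exact: IHn.
by lia.
Qed.

(* Contravariant finiteness in the heart extends to D^{>=1-d} because maps from
   M factor through the truncation below 0. *)
Lemma tilting_approx X : ext_ge P (1 - d%:Z) X ->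
  exists N (f : hom N X), right_approx M f.
Proof.
move=> PX; have [W [F [w [g [h [PW PF wgh]]]]]] := truncation P_tstr 0 X.
have HW : H W.
  rewrite dHE; split => // p k Pp kd; apply: (ext0_left wgh); last exact: PX.
  by apply: PF => //; lia.
have [N [f [MN fN]]] := M_cf HW; exists N, (w \oc f); split => // m u Mm.
have [|v vu] := dist_lift (u := u) wgh.
  apply: (tstr_ext0 P_tstr (i := 0)) PF _ _ => //.
  exact/heart_le/tilting_sub.
by have [e fe] := fN _ v Mm; exists e; rewrite -hcompA fe.
Qed.

(** * Construction of the torsion triangle *)

Lemma tilting_approx_shn (n : nat) X : ext_ge P (1 - d%:Z - n%:Z) X ->
  exists N (f : hom (shn n N) X), M N /\
    forall m (u : hom (shn n m) X), M m -> exists v, f \oc v = u.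
Proof.
move=> PX; set X' := sh (- n%:Z) X.
have PX' : ext_ge P (1 - d%:Z) X' by apply/ext_ge_sh.
have [e [e' [e'e ee']]] : iso_obj (shn n X') X.
  by have := sh_comp n (- n%:Z) X; rewrite subrr.
have [N [f [MN fN]]] := tilting_approx PX'.
exists N, (e \oc shiftnm n f); split => // m u Mm.
have [v Ev] := shiftnm_surj (e' \oc u); have [w fw] := fN _ v Mm.
by exists (shiftnm n w); rewrite -hcompA -shiftnm_comp fw Ev hcompA ee' hcomp1m.
Qed.

(** Each step replaces [Y] by the cone of an [M[n]]-approximation. By the octahedral axiom [C] is
    then extended by an object of [M[n+1]], which keeps its bound -1, while the lower bound of [Y]
    drops by one. *)
Lemma tilting_kill (n : nat) X : H X -> exists Y C (f : hom X Y) (g : hom Y C) h,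
  [/\ dist f g h, ext_le M (- 1) C, ext_ge P (1 - d%:Z - n%:Z) Y &
      forall m i, M m -> - n%:Z < i <= 0 -> ext0 m Y i].
Proof.
move=> HX; elim: n => [|n [Y [C [f [g [h [fgh MC PY MY]]]]]]].
  have [O O0] := exists_zero D; exists X, O, (idm X), 0, 0; split.
  - exact: dist_id.
  - by move=> m k _ _; exact: ext0_zero.
  - by rewrite subr0; exact: heart_ge.
  - by move=> m i _; lia.
have [N [a [MN aN]]] := tilting_approx_shn PY.
have [Y' [b [c abc]]] := dist_cone a.
have [C' [g' [h' fgh']]] := dist_cone (b \oc f).
have [u [v [uv _ _ _ _]]] := dist_octahedral fgh (dist_rotate abc) fgh'.
exists Y', C', (b \oc f), g', h'; split => //.
- move=> m k Mm k_ge0; apply: (ext0_mid uv); first exact: MC.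
  apply: (ext0_shr _ n.+1 _ _).2.
  by apply: (tilting_le MN) => //; lia.
- move=> p k Pp kd; apply: (ext0_right abc); first by apply: PY => //; lia.
  apply: (ext0_shr _ n _ _).2.
  by apply: (heart_ge (tilting_sub MN)) => //; lia.
(* In the new degree [-n] the approximation kills all maps; in the old degrees [Hom(m, N[n+i+1])] is
   zero, so nothing reappears. *)
- move=> m i Mm; have [->|ni] := eqVneq i (- n%:Z) => i_bound.
    apply: (@ext0_shn D n 0 _ m Y' _).2; first by lia.
    apply: (nohom_cone abc) => [u'|]; first exact: aN.
    apply: (@ext0_shn D n n.+1 1 m N _).1; first by lia.
    exact: (tilting_le MN).
  apply: (ext0_right abc); first by apply: MY => //; lia.
  apply: (ext0_shr _ n _ _).2.
  by apply: (tilting_le MN) => //; lia.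
Qed.

(** Replacing [p] by the last term of a coresolution of length at most [d] raises the degree by at
    most [d], so it stays in the range where [M] sees nothing. *)
Lemma tilting_ext0_heart p Y a j : P p ->
  (forall m i, M m -> a < i <= 0 -> ext0 m Y i) -> a < j <= - d%:Z ->
  ext0 p Y j.
Proof.
move=> Pp MY jd; have [r [Z [N [[<- MZr res] rd]]]] := coresolution_bounded Pp.
suff claim n : (n <= r)%N -> ext0 (Z (r - n)%N) Y (j + (r - n)%N%:Z).
  by have := claim r (leqnn r); rewrite subnn addr0.
elim: n => [_|n IHn nr]; first by rewrite subn0; apply: MY => //; lia.
have [|MN [f [g [h [_ _ _ fgh]]]]] := res (r - n)%N; first by lia.
have -> : (r - n.+1 = (r - n).-1)%N by lia.
apply: (ext0_leftl fgh); first by apply: MY => //; lia.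
rewrite (_ : _ + 1 = j + (r - n)%N%:Z); last by lia.
by apply: IHn; lia.
Qed.

Lemma tilting_torsion_triangle X : H X -> exists Y F,
  [/\ T Y, H F, (forall m i, M m -> i <= 0 -> ext0 m F i) & extriangle H Y X F].
Proof.
(* The number [d + d] of steps puts [W] in degrees at most [-2d], so that [Hom(m, W[k])] is zero for
   [k > -d], as the vanishing of [Hom(m, F[i])] for [i >= 1 - d] requires. *)
move=> HX; have [Y [C [f [g [h [fgh MC PY MY]]]]]] := tilting_kill (d + d) HX.
have [W [F [a [b [c [PW PF abc]]]]]] := truncation P_tstr d Y.
have PW' : ext_le P (- (d + d)%N%:Z) W.
  move=> p k Pp kd; have [dk|kd'] := ltP (- d%:Z) k; first exact: PW.
  apply: (ext0_left abc); first by apply: PF => //; lia.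
  by apply: tilting_ext0_heart Pp MY _; lia.
have [C' [g' [h' fgh']]] := dist_cone (b \oc f).
(* [C'] is an extension of [W[1]] by [C], and its desuspension will be the torsion part. *)
have [u [v [uv _ _ _ _]]] := dist_octahedral fgh (dist_rotate abc) fgh'.
have MC' : ext_le M (- 1) C'.
  move=> m k Mm k_ge0; apply: (ext0_mid uv); first exact: MC.
  apply: (ext0_shiftr _ _ _).2.
  by apply: (ext_le_heart_tilting PW) => //; lia.
have [T0 [t [s [tbf CT]]]] := dist_fiber fgh'.
have MT0 : ext_le M 0 T0.
  move=> m k Mm k_gt0; rewrite -(subrK 1 k); apply: (ext0_shiftr _ _ _).1.
  by apply: ext0_iso (iso_refl m) CT _; apply: MC' => //; lia.
have PT0 := ext_le_tilting_heart MT0.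
have HT0 : H T0.
  rewrite dHE; split=> // p k Pp kd.
  apply: (ext0_left tbf); first by apply: PF => //; lia.
  by apply: (heart_ge HX).
have HF : H F.
  rewrite dHE; split => // p k Pp k_gt0.
  apply: (ext0_right tbf); first exact: (heart_le HX).
  by apply: PT0 => //; lia.
exists T0, F; split => //; last by exists t, (b \oc f), s.
move=> m i Mm i_le0; have [id|di] := ltP i (1 - d%:Z).
  by apply: (tstr_ext0 P_tstr (heart_le (tilting_sub Mm)) PF).
apply: (ext0_right abc); first by apply: MY => //; lia.
by apply: (ext_le_heart_tilting PW') => //; lia.
Qed.

(** Each approximation of [X] by [M] with fibre in [T] lowers the degree by one; after at most [d]
    steps it is below [1 - d], where the t-structure gives vanishing. *)
Lemma tilting_perp_ext0 F : H F -> (forall m i, M m -> i <= 0 -> ext0 m F i) ->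
  forall X i, T X -> i <= 0 -> ext0 X F i.
Proof.
move=> HF MF X i TX i_le0.
suff claim n : forall X k, T X -> k <= 0 -> k <= n%:Z - d%:Z -> ext0 X F k.
  by apply: (claim d) => //; rewrite subrr.
elim: n => [|n IHn] {TX}X k TX k_le0 kd.
  by apply: (tstr_ext0 P_tstr (heart_le TX.1) (heart_ge HF)); lia.
have [Z [N [TZ MN [f [g [h [_ _ _ fgh]]]]]]] := tilting_perp_resolve TX.
apply: (ext0_rightl fgh); first by apply: IHn => //; lia.
exact: MF.
Qed.

(** * The s-torsion pair and the recovery of [M] *)

Lemma tilting_perp_subcategory : subcategory T.
Proof.
suff -> : T = ext_orth (fun W i =>
    (P W /\ (0 < i \/ i < 1 - d%:Z)) \/ (M W /\ 0 < i)).
  exact: ext_orth_subcategory.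
apply/seteqP; split=> [Y [] | Y JY].
  by rewrite dHE => -[Ple Pge] Mle W i [[PW []]|[MW]]; auto.
split; last by move=> W i MW i_gt0; apply: JY; right.
by rewrite dHE; split=> W i PW i_bound; apply: JY; left; auto.
Qed.

Lemma tilting_perp_storsion : storsion_class H T.
Proof.
(* Orthogonality in all degrees [i <= 0] covers the degrees 0 and -1 of an s-torsion pair and is
   what the torsion triangle provides. *)
set F := H `&` [set Y | forall X i, T X -> i <= 0 -> ext0 X Y i].
exists F; split.
- by split; [move=> X [] | exact: tilting_perp_subcategory].
- split; first by move=> X [].
  suff -> : F = ext_orth (fun W i =>
      (P W /\ (0 < i \/ i < 1 - d%:Z)) \/ (T W /\ i <= 0)).
    exact: ext_orth_subcategory.
  apply/seteqP; split=> [Y [] | Y JY].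
    by rewrite dHE => -[Ple Pge] Fle W i [[PW []]|[TW]]; auto.
  split; last by move=> W i TW i_le0; apply: JY; right.
  by rewrite dHE; split=> W i PW i_bound; apply: JY; left; auto.
- by move=> X Y TX [_ FY]; exact: FY.
- by move=> X Y TX [_ FY]; exact: FY.
- move=> X HX; have [Y [Z [TY HZ MZ YXZ]]] := tilting_torsion_triangle HX.
  by exists Y, Z; split => //; split => //; exact: tilting_perp_ext0.
Qed.

End Tilting.

(** Objects of [M] are Ext-projective in the common class, and [N] contains all Ext-projectives of
    that class. *)
Lemma tilting_Fac_sub (D : triangulated) (P : set D) (d : nat) (M N : set D) :
  P `<=` dH P d ->
  tilting (dH P d) P d M -> contravariantly_finite M (dH P d) ->
  tilting (dH P d) P d N -> contravariantly_finite N (dH P d) ->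
  Fac (dH P d) d M = Fac (dH P d) d N -> M `<=` N.
Proof.
move=> P_sub tM cM tN cN; rewrite (Fac_tilting tM cM) (Fac_tilting tN cN) => MN X MX.
apply: (tilting_perp_projective tN cN) => [|Z].
  by rewrite -MN; exact: (tilting_perp_sub tM).
by rewrite -MN => -[_ MZ]; exact: MZ.
Qed.

Theorem corollary4p10 (D : triangulated) (P : set D) (d : nat)
  (P_presilting : presilting P)
  (P_cf : contravariantly_finite P [set: D])
  (P_neg : exists m : int, m < 0 /\ forall i : int, i < m -> Hom0 P P i)
  (P_tstr : tstructure (Dle0 P) (Dge0 P))
  (P_nondeg : nondegenerate_tstr (Dle0 P) (Dge0 P))
  (d_gt0 : (0 < d)%N)
  (P_sub : P `<=` dH P d)
  (H_inj : enough_injectives (dH P d)) :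
  let H := dH P d in
  let tiltings := [set M : set D |
    [/\ tilting H P d M, contravariantly_finite M H & Euniversal H M]] in
  let classes := [set T : set D | storsion_class H T /\ Einjective H `<=` T] in
  set_fun tiltings classes (Fac H d) /\ set_inj tiltings (Fac H d).
Proof.
move=> H tiltings classes; split.
  move=> M [tM cM _]; rewrite /= /H (Fac_tilting tM cM); split.
    exact: (tilting_perp_storsion P_tstr P_sub tM cM).
  exact: (Einjective_tilting_perp tM).
move=> M N; rewrite !inE => -[tM cM _] [tN cN _] MN.
apply/seteqP; split.
  exact: (tilting_Fac_sub P_sub tM cM tN cN).
exact: (tilting_Fac_sub P_sub tN cN tM cM).
Qed.
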